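(* Let $G$ be a graph of minimum degree $\delta_1$ and maximum degree $\Delta_1$, and let $H$ be a graph of order $n_2$. Then $$\chi_{\le 3}(G\odot H)\le \chi_{\le 3}(G)+n_2(\Delta_1+1).$$ Moreover, if $G$ is triangle free, then $$\chi_{\le 3}(G\odot H)\ge 2n_2+\Delta_1+\delta_1.$$
   Context: All graphs are finite, undirected, without loops or multiple edges. The order of a graph is its number of vertices. For graphs $G$ and $H$, where $G$ has vertices $v_1,\dots,v_{n_1}$, the corona graph $G\odot H$ is obtained from one copy of $G$ and $n_1$ copies of $H$ by joining by an edge each vertex of the $i$-th copy of $H$ with the vertex $v_i$ of $G$. A distance-$k$ coloring of a graph is an assignment of colors to its vertices such that any two different vertices at distance at most $k$ receive different colors; $\chi_{\le k}(G)$ denotes the minimum number of colors in a distance-$k$ coloring of $G$.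
   Formalization: The lower bound is stated under the extra assumption that Δ_1 ≥ 1 or n_2 ≤ 1, since it is false for edgeless G with n_2 ≥ 2 (e.g. G = K_1, n_2 = 2: the corona has 3 vertices, so its χ_{≤3} is at most 3 < 4). *)

(* Defs.v *)
From mathcomp Require Import all_boot.

Set Implicit Arguments.
Unset Strict Implicit.
Unset Printing Implicit Defensive.

Record sgraph := SGraph {
  vertex :> finType;
  adj : rel vertex;
  adj_sym : symmetric adj;
  adj_irrefl : irreflexive adj
}.

Definition degree (G : sgraph) (v : G) : nat := #|[set u | adj v u]|.

(* A graph without vertices has neither a minimum nor a maximum degree. *)
Definition is_min_degree (G : sgraph) (d : nat) : Prop :=
  (exists v : G, degree v = d) /\ (forall v : G, d <= degree v).

Definition is_max_degree (G : sgraph) (d : nat) : Prop :=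
  (exists v : G, degree v = d) /\ (forall v : G, degree v <= d).

Definition triangle_free (G : sgraph) : Prop :=
  forall x y z : G, ~~ [&& adj x y, adj y z & adj z x].

Definition has_walk (G : sgraph) (n : nat) (x y : G) : bool :=
  [exists p : n.-tuple G, path (@adj G) x p && (last x p == y)].

(* The distance is a relation rather than a function: vertices in different
   components are at no (finite) distance from each other. *)
Definition at_distance (G : sgraph) (d : nat) (x y : G) : bool :=
  has_walk d x y && [forall i : 'I_d, ~~ has_walk i x y].

Definition distance_le (G : sgraph) (k : nat) (x y : G) : bool :=
  [exists d : 'I_k.+1, at_distance d x y].

Definition distance_coloring (G : sgraph) (k : nat) (C : eqType) (f : G -> C)
  : bool :=
  [forall x, forall y, (x != y) && distance_le k x y ==> (f x != f y)].

Definition distance_colorable (G : sgraph) (k n : nat) : bool :=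
  [exists f : {ffun G -> 'I_n}, distance_coloring k f].

Lemma distance_colorable_order (G : sgraph) (k : nat) :
  distance_colorable G k #|G|.
Proof.
apply/existsP; exists [ffun x => enum_rank x].
apply/forallP=> x; apply/forallP=> y; apply/implyP=> /andP[xy _].
by rewrite !ffunE (inj_eq enum_rank_inj).
Qed.

Lemma distance_colorable_ex (G : sgraph) (k : nat) :
  exists n, distance_colorable G k n.
Proof. by exists #|G|; apply: distance_colorable_order. Qed.

Definition chi_le (k : nat) (G : sgraph) : nat :=
  ex_minn (distance_colorable_ex G k).

Section Corona.
Variables G H : sgraph.

(* inl v is the vertex v of G; inr (v, x) is the vertex x of the copy of H
   attached to v. *)
Definition corona_adj : rel (G + G * H)%type := fun a b =>
  match a, b with
  | inl u, inl v => adj u v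
  | inl u, inr (v, _) => u == v
  | inr (u, _), inl v => u == v
  | inr (u, x), inr (v, y) => (u == v) && adj x y
  end.

Lemma corona_adj_sym : symmetric corona_adj.
Proof.
by move=> [u|[u x]] [v|[v y]] /=; rewrite 1?(adj_sym u) 1?(adj_sym x) 1?eq_sym.
Qed.

Lemma corona_adj_irrefl : irreflexive corona_adj.
Proof. by move=> [u|[u x]] /=; rewrite adj_irrefl ?andbF. Qed.

Definition corona : sgraph := SGraph corona_adj_sym corona_adj_irrefl.

End Corona.

(* Main.v *)
(** Upper bound: an optimal coloring of [G] extends to the corona by giving the
    copies of [H] fresh colors, in pairwise disjoint blocks of [n2] colors chosen
    according to a greedy proper coloring of [G] with [Delta1 + 1] colors; this
    works because two distinct copies come within distance 3 only when they are
    attached to adjacent vertices.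
    Lower bound: the neighbors of the two ends of an edge are pairwise within
    distance 3. For an edge of [G] at a vertex of maximum degree, triangle-freeness
    makes the two corona neighborhoods disjoint. *)
Require Import Defs.
From mathcomp Require Import all_boot.

Set Implicit Arguments.
Unset Strict Implicit.
Unset Printing Implicit Defensive.

(** A shortest walk is no longer than the given one and realizes the distance, so later arguments
    need only exhibit walks, never minimal ones. *)
Lemma distance_leP (G : sgraph) (k : nat) (x y : G) :
  reflect (exists p, [/\ path (@adj G) x p, last x p = y & size p <= k])
          (distance_le k x y).
Proof.
apply: (iffP existsP) =>
  [[d /andP[/existsP[p /andP[px /eqP lp]] _]] | [p [px lp sp]]].
  by exists p; rewrite size_tuple -ltnS.
have walk : exists n, has_walk n x y.
  by exists (size p); apply/existsP; exists (in_tuple p); rewrite px lp eqxx.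
case: (ex_minnP walk) => n wn nmin.
have lenk : n <= k.
  apply: leq_trans sp; apply: nmin; apply/existsP.
  by exists (in_tuple p); rewrite px lp eqxx.
exists (Ordinal (lenk : n < k.+1)); rewrite /at_distance wn; apply/forallP=> i.
by apply: contraL (ltn_ord i) => /nmin; rewrite -leqNgt.
Qed.

Lemma distance_coloring_neq (G : sgraph) (k : nat) (C : eqType) (f : G -> C)
    (x y : G) :
  distance_coloring k f -> x != y -> distance_le k x y -> f x != f y.
Proof.
by move=> /forallP/(_ x)/forallP/(_ y)/implyP fP xy xyk; apply: fP; rewrite xy.
Qed.

Lemma chi_leP (k : nat) (G : sgraph) :
  exists f : {ffun G -> 'I_(chi_le k G)}, distance_coloring k f.
Proof. by apply/existsP; rewrite /chi_le; case: ex_minnP. Qed.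

Lemma chi_le_card (k : nat) (G : sgraph) (C : finType) (f : G -> C) :
  distance_coloring k f -> chi_le k G <= #|C|.
Proof.
move=> fP; rewrite /chi_le; case: ex_minnP => n _; apply.
apply/existsP; exists [ffun x => enum_rank (f x)].
apply/forallP=> x; apply/forallP=> y; apply/implyP=> /andP[xy xyk].
by rewrite !ffunE (inj_eq enum_rank_inj) (distance_coloring_neq fP).
Qed.

(** [S] is a clique of the [k]-th power of [G], so every distance-[k] coloring is injective on
    it. *)
Lemma card_le_chi_le (k : nat) (G : sgraph) (S : {set G}) :
  {in S &, forall x y, distance_le k x y} -> #|S| <= chi_le k G.
Proof.
move=> SP; have [f fP] := chi_leP k G.
rewrite -[chi_le k G]card_ord -(@card_in_imset _ _ f S) ?max_card //.
move=> x y xS yS fxy; apply/eqP; apply: contraTT isT => xy.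
by have := distance_coloring_neq fP xy (SP x y xS yS); rewrite fxy eqxx.
Qed.

Lemma edge_neighborhood_le_chi_le3 (G : sgraph) (u v : G) : adj u v ->
  #|[set x | adj u x] :|: [set x | adj v x]| <= chi_le 3 G.
Proof.
move=> uv; apply: card_le_chi_le => x y; rewrite !inE.
have vu : adj v u by rewrite adj_sym.
move=> /orP[] ux /orP[] vy; apply/distance_leP.
- by exists [:: u; y]; rewrite /= adj_sym ux vy.
- by exists [:: u; v; y]; rewrite /= adj_sym ux uv vy.
- by exists [:: v; u; y]; rewrite /= adj_sym ux vu vy.
- by exists [:: v; y]; rewrite /= adj_sym ux vy.
Qed.

Lemma greedy_coloring (G : sgraph) (D : nat) : (forall v : G, degree v <= D) ->
  exists c : G -> 'I_D.+1, forall u v, adj u v -> c u != c v.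
Proof.
move=> degD.
(* Vertices are colored one at a time; properness is only required among those already listed. *)
suff [c cP] : exists c : G -> 'I_D.+1,
    {in enum G &, forall u v, adj u v -> c u != c v}.
  by exists c => u v; apply: cP; rewrite mem_enum.
elim: (enum G) => [|w s [c cP]]; first by exists (fun=> ord0).
(* The at most [D] neighbors of [w] leave one of the [D.+1] colors free. *)
have /set0Pn[a] : ~: (c @: [set u | adj w u]) != set0.
  rewrite -card_gt0 cardsCs setCK card_ord subn_gt0 ltnS.
  by apply: leq_trans (leq_imset_card _ _) (degD w).
rewrite inE => aP.
have cNa u : adj w u -> c u != a.
  by move=> wu; apply: contraNneq aP => <-; apply: imset_f; rewrite inE.
exists (fun u => if u == w then a else c u) => u v; rewrite !inE.
case: (u =P w) => [-> _|_ /= us]; case: (v =P w) => [-> _|_ /= vs].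
- by rewrite adj_irrefl.
- by move=> /cNa; rewrite eq_sym.
- by rewrite adj_sym => /cNa.
- exact: cP.
Qed.

Section CoronaDistance.
Variables G H : sgraph.

(** Contracting each copy of [H] to its root turns corona walks into walks of [G], which bounds
    corona distances from below. *)
Definition corona_base (a : corona G H) : G :=
  match a with inl u => u | inr (u, _) => u end.

Definition corona_leaf (a : corona G H) : bool :=
  if a is inr _ then true else false.

(* Entering or leaving a copy of [H] costs one step, unless the walk stays in
   that copy. *)
Lemma corona_path_base (a : corona G H) p : path (@adj (corona G H)) a p ->
  let b := last a p in
  exists q, [/\ path (@adj G) (corona_base a) q,
    last (corona_base a) q = corona_base b &
    (size q + corona_leaf a + corona_leaf b <= size p) ||
    [&& corona_leaf a, corona_leaf b & corona_base a == corona_base b]].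
Proof.
elim: p a => [|c p IH] a /=.
  by exists [::]; split=> //; case: a => [u|[u x]] //=; rewrite eqxx.
move=> /andP[ac /IH[q [qp ql qs]]]; move: (last c p) ql qs => b ql qs.
case: a ac => [u|[u x]]; case: c qp ql qs => [v|[v y]] /=; rewrite ?andbF ?orbF ?addn0.
- by move=> vq ql qs uv; exists (v :: q); rewrite /= uv addn0 orbF.
(* The walk enters a copy of [H]. If the rest counts as staying there, the empty walk at the root
   works: the entering step pays for the final leaf. *)
- move=> vq ql + /eqP uv; rewrite -{}uv in vq ql * => /orP[qs|/andP[-> /eqP->]].
    exists q; rewrite orbF addn0; split=> //.
    by apply: leq_trans (leqW qs); rewrite leq_add2r leq_addr.
  by exists [::].
- by move=> vq ql qs /eqP->; exists q; rewrite addn1 addSn ltnS qs.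
- move=> vq ql qs /andP[/eqP-> _]; exists q; split=> //.
  by case/orP: qs => [/leqW->|->] //; rewrite orbT.
Qed.

Lemma corona_distance_inl k (u v : G) :
  distance_le k (inl u : corona G H) (inl v) -> distance_le k u v.
Proof.
move=> /distance_leP[p [/corona_path_base + pl ps]]; rewrite pl /=.
move=> [q [qp ql]]; rewrite orbF !addn0 => qs.
by apply/distance_leP; exists q; split=> //; apply: leq_trans ps.
Qed.

Lemma corona_distance3_inr (u v : G) (x y : H) :
  distance_le 3 (inr (u, x) : corona G H) (inr (v, y)) -> (u == v) || adj u v.
Proof.
move=> /distance_leP[p [/corona_path_base + pl ps]]; rewrite pl /=.
move=> [q [qp ql /orP[qs|->//]]].
(* Leaving one copy and entering the other use two of the three steps. *)
have : size q <= 1.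
  by rewrite -addnA in qs; rewrite -(leq_add2r 2); apply: leq_trans ps.
case: q qp ql {qs} => [|w [|//]] /= => [_ ->|]; first by rewrite eqxx.
by rewrite andbT => + <- _ => ->; rewrite orbT.
Qed.

(** A root and a leaf get colors from different summands. Close leaves differ in the [H] component
    within one copy, and in the [c] component across adjacent copies. *)
Lemma corona_coloring (k D : nat) (f : G -> 'I_k) (c : G -> 'I_D) :
  distance_coloring 3 f -> (forall u v, adj u v -> c u != c v) ->
  @distance_coloring (corona G H) 3 ('I_k + H * 'I_D)%type
    (fun a => match a with inl u => inl (f u) | inr (u, x) => inr (x, c u) end).
Proof.
move=> fP cP; apply/forallP=> -[u|[u x]]; apply/forallP=> -[v|[v y]] //;
  apply/implyP=> /andP[] //.
- move=> uv /corona_distance_inl; rewrite (inj_eq inl_inj).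
  by apply: distance_coloring_neq => //; apply: contraNneq uv => ->.
- move=> + /corona_distance3_inr uv; rewrite !(inj_eq inr_inj).
  case: eqP uv => [->|_ /= /cP cuv] _; last by rewrite xpair_eqE negb_and cuv orbT.
  by apply: contraNneq => -[->].
Qed.

Lemma degree_corona_inl (u : G) :
  degree (inl u : corona G H) = degree u + #|H|.
Proof.
rewrite /degree -!sum1dep_card big_sumType /=; congr (_ + _).
rewrite (eq_bigl (fun p => (p.1 == u) && xpredT p.2)) => [|[v x]]; last first.
  by rewrite andbT eq_sym.
by rewrite -(pair_big (pred1 u) xpredT (fun _ _ => 1)) big_pred1_eq sum1_card.
Qed.

(** A common neighbor in [G] would close a triangle, and a leaf is attached to a single root. *)
Lemma corona_neighbors_disjoint (u v : G) : triangle_free G -> adj u v ->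
  [set x | adj (inl u : corona G H) x] :&: [set x | adj (inl v : corona G H) x]
    = set0.
Proof.
move=> tf uv; apply/setP=> -[w|[w x]]; rewrite !inE /=.
  apply/negbTE; have := tf u w v.
  by rewrite [adj w v]adj_sym [adj v u]adj_sym uv andbT.
by case: eqP => //= <-; apply/negbTE; apply: contraTneq uv => ->; rewrite adj_irrefl.
Qed.

End CoronaDistance.

Theorem theorem5 (G H : sgraph) (delta1 Delta1 n2 : nat)
    (hdelta : is_min_degree G delta1) (hDelta : is_max_degree G Delta1)
    (hn2 : #|H| = n2) :
  chi_le 3 (corona G H) <= chi_le 3 G + n2 * (Delta1 + 1) /\
  (triangle_free G -> 0 < Delta1 \/ n2 <= 1 ->
   2 * n2 + Delta1 + delta1 <= chi_le 3 (corona G H)).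
Proof.
case: hdelta hDelta => _ min_deg [[u deg_u] max_deg]; split.
  have [f fP] := chi_leP 3 G; have [c cP] := greedy_coloring max_deg.
  have := chi_le_card (corona_coloring H fP cP).
  by rewrite card_sum card_prod !card_ord hn2 addn1.
(* If [Delta1 = 0], the corona consists of disjoint cones over [H], which need exactly [n2 + 1]
   colors; this reaches [2 * n2] only when [n2 <= 1]. *)
move=> tf side; have [Delta1_0|Delta1_gt0] := posnP Delta1.
  have delta1_0 : delta1 = 0.
    by apply/eqP; rewrite -leqn0 -Delta1_0 -deg_u.
  have {side} n2_le1 : n2 <= 1 by case: side; rewrite ?Delta1_0.
  rewrite Delta1_0 delta1_0 !addn0.
  have [->//|n2_gt0] := posnP n2.
  have /card_gt0P[x _] : 0 < #|H| by rewrite hn2.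
  pose a : corona G H := inl u; pose b : corona G H := inr (u, x).
  have ab : adj a b by rewrite /= eqxx.
  apply: leq_trans (edge_neighborhood_le_chi_le3 ab).
  (* Each end of the edge is a neighbor of the other, which gives the two colors required for
     [n2 = 1]. *)
  apply: (@leq_trans #|[set a; b]|); first by rewrite cards2; case: (n2) n2_le1 => [|[]].
  apply/subset_leq_card/subsetP=> y; rewrite !inE.
  by case/orP=> /eqP->; rewrite /= eqxx ?orbT.
have /card_gt0P[v] : 0 < #|[set v | adj u v]| by rewrite -/(degree u) deg_u.
rewrite inE => uv; have auv : adj (inl u : corona G H) (inl v) by [].
apply: leq_trans (edge_neighborhood_le_chi_le3 auv).
(* The two disjoint neighborhoods have [Delta1 + n2] and [degree v + n2] elements, and
   [delta1 <= degree v]. *)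
rewrite cardsU corona_neighbors_disjoint // cards0 subn0.
rewrite -!/(degree _) !degree_corona_inl hn2 deg_u addnACA [leqRHS]addnC.
by rewrite mul2n -addnn -[leqLHS]addnA !leq_add2l.
Qed.
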